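(* Let $f:\mathbb{R}^\infty\to\mathbb{R}$ be a measurable function such that $f\ge 0$ and $\int_{\mathbb{R}^\infty} f\,d\lambda^\infty=1$. Then for $\lambda^\infty$-almost every $x\in\mathbb{R}^\infty$, $$\lim_{\substack{\Pi \text{ with centre } x\\ 0<\lambda^\infty(\Pi)<\infty\\ \lambda^\infty(\Pi)\to 0}}\ \frac{1}{\lambda^\infty(\Pi)}\int_{\Pi} f(y)\,d\lambda^\infty(y)=0,$$ where $\Pi$ ranges over the infinite-dimensional parallelepipeds with centre $x$.
   Context: $\mathbb{R}^\infty$ is the countable product of copies of $\mathbb{R}$ with the product topology and its Borel $\sigma$-algebra. Let $\mathfrak{R}$ be the family of all sets $R=\prod_{i=1}^\infty(a_i,b_i)\subseteq\mathbb{R}^\infty$ with $-\infty<a_i\le b_i<+\infty$ such that $\xi(R):=\prod_{i=1}^\infty(b_i-a_i)=\lim_{d\to\infty}\prod_{i=1}^d(b_i-a_i)$ exists and $0\le\xi(R)<+\infty$. The ''infinite-dimensional Lebesgue measure'' $\lambda^\infty$ is defined for $E\subseteq\mathbb{R}^\infty$ by $$\lambda^\infty(E)=\inf\Big\{\sum_{j=1}^\infty\xi(R_j): R_j\in\mathfrak{R},\ \bigcup_{j} R_j\supseteq E\Big\},\qquad \inf\emptyset=+\infty .$$ It is an outer measure whose restriction to the Borel sets is a translation-invariant (not $\sigma$-finite) measure, and $\lambda^\infty(R)=\xi(R)$ for $R\in\mathfrak{R}$. ''Measurable'' means Borel measurable; ''almost every'' means outside a set of $\lambda^\infty$-measure zero.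 A parallelepiped is a set $\Pi=\prod_{i=1}^\infty[a_i,b_i]$ with $-\infty<a_i\le b_i<\infty$; its centre is the point $\left(\frac{a_i+b_i}{2}\right)_{i=1}^\infty$. The limit means: for every $\varepsilon>0$ there is $\delta>0$ such that for every parallelepiped $\Pi$ with centre $x$ and $0<\lambda^\infty(\Pi)<\delta$, the displayed average has absolute value less than $\varepsilon$. *)

(* Defs.v *)
From HB Require Import structures.
From mathcomp Require Import all_boot all_order all_algebra.
From mathcomp Require Import all_classical all_reals all_analysis.

Set Implicit Arguments.
Unset Strict Implicit.
Unset Printing Implicit Defensive.

Import Order.TTheory GRing.Theory Num.Theory.
Import numFieldNormedType.Exports.

Local Open Scope classical_set_scope.
Local Open Scope ring_scope.

(* R^oo with the product topology; coordinates are indexed from 0. *)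
Definition Rinfty (R : realType) := prod_topology (fun _ : nat => R).

HB.instance Definition _ (R : realType) := Topological.on (Rinfty R).
HB.instance Definition _ (R : realType) := Pointed.on (Rinfty R).

Definition borelRinfty (R : realType) : measurableType _ :=
  g_sigma_algebraType (@open (Rinfty R)).

Section lebesgue_infty.
Variable R : realType.
Implicit Types (a b : nat -> R).

Definition open_box a b : set (borelRinfty R) :=
  [set x | forall i, a i < x i < b i].

Definition parallelepiped a b : set (borelRinfty R) :=
  [set x | forall i, a i <= x i <= b i].

Definition centre a b : borelRinfty R := fun i => (a i + b i) / 2.

Definition partial_volume a b : R^nat :=
  fun d => \prod_(i < d) (b i - a i).

(* [volume a b] has a meaning only when the partial products converge in R,
   which [admissible_box] requires. *)
Definition volume a b : R := limn (partial_volume a b).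

Definition admissible_box a b : Prop :=
  (forall i, a i <= b i) /\ cvgn (partial_volume a b).

(* An outer measure, defined on all sets. Integrals against it only involve its
   values on Borel sets, where it is a measure. *)
Definition lebesgue_infty (E : set (borelRinfty R)) : \bar R :=
  ereal_inf [set s | exists a b : nat -> nat -> R,
    [/\ forall j, admissible_box (a j) (b j),
        E `<=` \bigcup_j open_box (a j) (b j) &
        s = (\sum_(0 <= j <oo) (volume (a j) (b j))%:E)%E]].

End lebesgue_infty.

(* Main.v *)
Require Import Defs.
From mathcomp Require Import all_boot all_order all_algebra.
From mathcomp Require Import all_classical all_reals all_analysis.
From mathcomp Require Import lra.

Set Implicit Arguments.
Unset Strict Implicit.
Unset Printing Implicit Defensive.

Import Order.TTheory GRing.Theory Num.Theory.
Import numFieldNormedType.Exports.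

(** The averages do not merely tend to 0: for almost every centre [x] they all
vanish. The reason is that in infinite dimension two boxes of finite positive
volume meet in a null set as soon as their centres are not asymptotic.

If [\prod_i (b i - a i)] converges to a nonzero limit, then the sides tend to 1
([prod_cvg_factor_cvg1]). Hence a box centred at [x] and a box centred at [c]
with [`|x i - c i| >= 1/4] for infinitely many [i] have an intersection whose
[i]th side is, for infinitely many [i], at most a fixed fraction of the side of
the second box, so that its volume is 0 ([flat_parallelepiped_open_box]). On the
other hand the points [x] that are eventually within 1/4 of a given [c] form a
null set, being covered by countably many boxes whose sides are eventually 1/2
([flat_asymptotic]).

As [f] is integrable, each [[set x | n.+1%:R^-1 <= f x]] has finite outer
measure, so [f] vanishes outside countably many admissible boxes
([integrable_support_cover]). Discard the points asymptotic to the centre of one of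
them. For any other [x], every parallelepiped of finite positive measure centred
at [x] meets each of these boxes in a null set, and the integral of [f] over it
is 0.

Nothing is assumed on the partial products of a parallelepiped of finite
positive outer measure; what makes the argument work is that the upper limit of
its sides is at most 1 ([parallelepiped_side_lt]). This comes from a diagonal
argument: a countable cover by open boxes must contain a box that encloses the
parallelepiped in all but finitely many coordinates, since otherwise a point
could be built that escapes the [j]th box in a coordinate chosen for [j]
([parallelepiped_cover_tail]).

All the null sets involved are covered by countably many boxes each of volume
exactly 0, which makes countable unions immediate; [flat] names this property.
Since [lebesgue_infty] is an outer measure, not a bundled measure, the few facts
about integrals are proved for an arbitrary set function vanishing on [set0]. *)

Local Open Scope classical_set_scope.
Local Open Scope ring_scope.

(** * Infinite products *)

Section partial_products.
Variable R : realType.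
Implicit Types u v r : nat -> R.

Lemma prod_tail_eq u v n : (forall i, (i < n)%N -> v i != 0) ->
  (forall i, (n <= i)%N -> u i = v i) -> exists C : R, forall d, (n <= d)%N ->
  \prod_(i < d) u i = C * \prod_(i < d) v i.
Proof.
move=> v0 uv; exists (\prod_(i < n) u i / \prod_(i < n) v i) => d nd.
have v0' : \prod_(i < n) v i != 0.
  by apply/prodf_neq0 => i _; apply: v0.
elim: d nd => [|d IH].
  by rewrite leqn0 => /eqP n0; subst n; rewrite !big_ord0 divr1 mulr1.
rewrite leq_eqVlt => /predU1P[<-|]; first by rewrite divfK.
by rewrite ltnS => nd; rewrite !big_ord_recr/= IH// uv// mulrA.
Qed.

Lemma prod_tail_cvg0 u v n : (forall i, (i < n)%N -> v i != 0) ->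
  (forall i, (n <= i)%N -> u i = v i) ->
  (fun d => \prod_(i < d) v i) @ \oo --> (0 : R) ->
  (fun d => \prod_(i < d) u i) @ \oo --> (0 : R).
Proof.
move=> v0 uv cv; have [C uC] := prod_tail_eq v0 uv.
have : (fun d => C * \prod_(i < d) v i) @ \oo --> C * 0.
  exact: cvgMl_tmp.
rewrite mulr0; apply: cvg_trans; apply: near_eq_cvg.
by exists n => // d /= nd; rewrite uC.
Qed.

(** Each index where [u i <= q * r i] contributes one more factor [q], and the
products of [r] are bounded, being convergent. *)
Lemma prod_contract_cvg0 u r (q : R) : 0 <= q < 1 ->
  (forall i, 0 <= u i <= r i) ->
  (forall n, exists2 i, (n <= i)%N & u i <= q * r i) ->
  cvgn (fun d => \prod_(i < d) r i) ->
  (fun d => \prod_(i < d) u i) @ \oo --> (0 : R).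
Proof.
move=> /andP[q0 q1] ur hit cr.
have r0 i : 0 <= r i by have /andP[/le_trans] := ur i; exact.
have u0 i : 0 <= u i by have /andP[] := ur i.
have key m : exists n, forall d, (n <= d)%N ->
    \prod_(i < d) u i <= q ^+ m * \prod_(i < d) r i.
  (* Once reached, the bound persists because [u] is dominated by [r]; the next
     contracting index turns [q ^+ m] into [q ^+ m.+1]. *)
  elim: m => [|m [n IH]].
    exists 0%N => d _; rewrite expr0 mul1r; apply: ler_prod => i _; exact: ur.
  have [k nk uk] := hit n; exists k.+1; elim=> // d IHd.
  rewrite ltnS leq_eqVlt => /predU1P[<-|kd].
    rewrite !big_ord_recr/= exprS.
    rewrite [leRHS](_ : _ = (q ^+ m * \prod_(i < k) r i) * (q * r k)); last first.
      by rewrite [q * _]mulrC -!mulrA; congr (_ * _); rewrite mulrCA.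
    by apply: ler_pM (IH k nk) uk => //; exact: prodr_ge0.
  rewrite !big_ord_recr/= mulrA; apply: ler_pM (IHd kd) _ => //.
    exact: prodr_ge0.
  by have /andP[] := ur d.
have [M [_ /(_ (M + 1))]] := cvg_seq_bounded cr.
rewrite ltrDl ltr01 => /(_ isT) rM.
have cq : (fun m => q ^+ m * (M + 1)) @ \oo --> 0 * (M + 1).
  by apply: cvgMr_tmp; apply: cvg_expr; rewrite ger0_norm.
rewrite mul0r in cq.
apply/cvgrPdist_le => e e0.
move/cvgrPdist_le : cq => /(_ e e0)[m _ /(_ m (leqnn m))] /=.
rewrite sub0r normrN => qe.
have [n nP] := key m; exists n => // d /= nd.
rewrite sub0r normrN ger0_norm ?prodr_ge0//.
apply: (le_trans (nP d nd)); apply: le_trans qe.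
apply: le_trans (ler_norm _); apply: ler_wpM2l; first exact: exprn_ge0.
by apply: le_trans (ler_norm _) (rM d I).
Qed.

(** A factor is the quotient of two consecutive partial products. *)
Lemma prod_cvg_factor_cvg1 r (l : R) : l != 0 ->
  (fun d => \prod_(i < d) r i) @ \oo --> l -> r @ \oo --> (1 : R).
Proof.
move=> l0 cr; set P := fun d => _ in cr.
have cP1 : (fun d => P d.+1) @ \oo --> l by rewrite (cvg_shiftS P).
have cPV : (fun d => (P d)^-1) @ \oo --> l^-1 by apply: cvgV.
rewrite -(divff l0); apply: cvg_trans (cvgM cP1 cPV).
apply: near_eq_cvg.
have : \forall d \near \oo, P d != 0 by exact: (cvgr_neq0 _ cr).
apply: filterS => d Pd0 /=.
by rewrite {1}/P big_ord_recr/= -/(P d) mulrAC divff// mul1r.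
Qed.

End partial_products.

(** * Null sets covered by boxes of volume zero *)

Section flat_sets.
Variable R : realType.
Implicit Types (a b : nat -> R) (E F : set (borelRinfty R)).

Definition flat_box a b : Prop :=
  (forall i, a i <= b i) /\ partial_volume a b @ \oo --> (0 : R).

(** This is stronger than having measure zero: every covering box has volume
exactly 0, so that covers can be merged without any choice of epsilons. *)
Definition flat E : Prop := exists a b : nat -> nat -> R,
  (forall j, flat_box (a j) (b j)) /\ E `<=` \bigcup_j open_box (a j) (b j).

Lemma flat_boxP a b : flat_box a b <-> admissible_box a b /\ volume a b = 0.
Proof.
split=> [[ab cv]|[[ab cv] v0]].
  split; last exact/cvg_lim.
  by split=> //; apply/cvg_ex; exists 0.
by split=> //; rewrite -v0.
Qed.

Lemma flat_open_box a b : flat_box a b -> flat (open_box a b).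
Proof. by move=> ab; exists (fun=> a), (fun=> b); split=> // x xab; exists 0%N. Qed.

Lemma flat_subset E F : E `<=` F -> flat F -> flat E.
Proof. by move=> EF [a [b [ab Fab]]]; exists a, b; split=> // x /EF/Fab. Qed.

Lemma flat_box00 : flat_box (fun=> 0 : R) (fun=> 0).
Proof.
split=> //; apply: cvg_near_cst; exists 1%N => // d /= d0.
by rewrite /partial_volume -(prednK d0) big_ord_recl/= subrr mul0r.
Qed.

Lemma flat0 : flat set0.
Proof. exact: flat_subset (flat_open_box flat_box00). Qed.

Lemma flat_bigcup (E : nat -> set (borelRinfty R)) :
  (forall n, flat (E n)) -> flat (\bigcup_n E n).
Proof.
move=> /choice[a] /choice[b] abE.
pose dec k := odflt (0%N, 0%N) (unpickle k : option (nat * nat)).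
exists (fun k => a (dec k).1 (dec k).2), (fun k => b (dec k).1 (dec k).2).
split=> [k|x [n _ Ex]]; first by have [] := abE (dec k).1.
have [_ /(_ x Ex)[j _ xj]] := abE n.
by exists (pickle (n, j)) => //=; rewrite /dec pickleK.
Qed.

Lemma volume_ge0 a b : admissible_box a b -> 0 <= volume a b.
Proof.
move=> [ab cv]; apply: limr_ge => //; apply: nearW => d.
by apply: prodr_ge0 => i _; rewrite subr_ge0.
Qed.

Lemma lebesgue_infty_flat E : flat E -> lebesgue_infty E = 0%E.
Proof.
move=> [a [b [ab Eab]]]; apply/eqP; rewrite eq_le; apply/andP; split.
  apply: ereal_inf_lbound; exists a, b; split=> //.
    by move=> j; have /flat_boxP[] := ab j.
  rewrite eseries0// => j _ _; by have /flat_boxP[_ ->] := ab j.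
apply: le_ereal_inf_tmp => _ [a' [b' [adm _ ->]]].
by apply: nneseries_ge0 => j _ _; rewrite lee_fin volume_ge0.
Qed.

Lemma lebesgue_infty0 : @lebesgue_infty R set0 = 0%E.
Proof. exact: lebesgue_infty_flat flat0. Qed.

Lemma measurable_open_box a b : measurable (open_box a b).
Proof.
have -> : open_box a b =
    \bigcap_i [set x : borelRinfty R | a i < x i < b i].
  by apply/seteqP; split=> [x xab i _|x xab i] /=; [exact: xab|exact: xab i I].
apply: bigcapT_measurable => i; apply: sub_sigma_algebra.
have pc := (@continuousP (Rinfty R) R (fun x => x i)).1 (@proj_continuous nat (fun=> R) i).
exact: pc _ (@interval_open R (BRight (a i)) (BLeft (b i)) erefl erefl).
Qed.

(** The union of the covering boxes is the Borel null set that negligibility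
asks for. *)
Lemma flat_negligible E : flat E -> (@lebesgue_infty R).-negligible E.
Proof.
move=> [a [b [ab Eab]]]; exists (\bigcup_j open_box (a j) (b j)); split=> //.
  by apply: bigcupT_measurable => j; exact: measurable_open_box.
by apply: lebesgue_infty_flat; exists a, b; split.
Qed.

(** A set without admissible cover would have measure [ereal_inf set0 = +oo]. *)
Lemma lebesgue_infty_cover E : (lebesgue_infty E < +oo)%E ->
  exists a b : nat -> nat -> R,
    (forall j, admissible_box (a j) (b j)) /\
    E `<=` \bigcup_j open_box (a j) (b j).
Proof.
rewrite /lebesgue_infty; set S := [set _ | _] => Soo.
have [[_ [a [b [adm Eab _]]]]|S0] := pselect (S !=set0); first by exists a, b.
by move/nonemptyPn : S0 Soo => ->; rewrite ereal_inf0 ltxx.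
Qed.

End flat_sets.

(** * Integrals against a set function *)

Section set_function_integral.
Local Open Scope ereal_scope.
Context d (T : measurableType d) (R : realType) (mu : set T -> \bar R).
Hypothesis mu0 : mu set0 = 0.
Import HBNNSimple.

Lemma sintegral_eq0 (h : {nnsfun T >-> R}) :
  (forall r, (0 < r)%R -> mu (h @^-1` [set r]) = 0) -> sintegral mu h = 0.
Proof.
move=> hr; apply: fsbig1 => r _.
have [r0|r0|<-] := ltgtP 0%R r; last by rewrite mul0e.
  by rewrite hr// mule0.
rewrite (_ : _ @^-1` _ = set0) ?mu0 ?mule0//.
rewrite -subset0 => x /= hx.
have : (0 <= h x)%R by exact: fun_ge0.
by rewrite hx leNgt r0.
Qed.

Lemma sintegral_nnsfun0 : sintegral mu (@nnsfun0 d T R) = 0.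
Proof.
apply: sintegral_eq0 => r r0; rewrite (_ : _ @^-1` _ = set0) ?mu0//.
by rewrite -subset0 => x /= rE; move: r0; rewrite -rE ltxx.
Qed.

Lemma set_function_ge0_integralE (D : set T) (f : T -> \bar R) :
  (forall x, 0 <= f x) ->
  integral mu D f = ereal_sup [set sintegral mu h | h in
    [set h : {nnsfun T >-> R} | forall x, (h x)%:E <= (f \_ D) x]].
Proof.
move=> f0; rewrite /integral.
have fD0 x : 0 <= (f \_ D) x by rewrite patchE; case: ifP.
have fDT x : setT x -> 0 <= (f \_ D) x by [].
rewrite (_ : (f \_ D)^\+ = f \_ D); last first.
  by apply/funext => x; rewrite (ge0_funeposE fDT) ?inE.
rewrite (_ : (f \_ D)^\- = cst 0); last first.
  by apply/funext => x; rewrite (ge0_funenegE fDT) ?inE.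
rewrite (_ : [set sintegral mu h | h in
    [set h : {nnsfun T >-> R} | forall x, (h x)%:E <= cst 0 x]] = [set 0]).
  by rewrite ereal_sup1 sube0.
apply/seteqP; split=> [_ [h /= h0 <-]|_ ->].
  apply: sintegral_eq0 => r r0.
  rewrite (_ : _ @^-1` _ = set0) ?mu0//.
  by rewrite -subset0 => x /= hx; have := h0 x; rewrite hx lee_fin leNgt r0.
by exists nnsfun0 => //; exact: sintegral_nnsfun0.
Qed.

(** Markov's inequality: [c] times the indicator of [A] is one of the simple
functions below [f]. *)
Lemma le_set_function_integral (c : R) (A : set T) (f : T -> \bar R) :
  (0 < c)%R -> measurable A -> (forall x, 0 <= f x) ->
  (forall x, A x -> c%:E <= f x) -> c%:E * mu A <= \int[mu]_(x in setT) f x.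
Proof.
move=> c0 mA f0 cf; rewrite set_function_ge0_integralE//.
have {1}-> : c%:E * mu A = sintegral mu (scale_nnsfun (indic_nnsfun R mA) (ltW c0)).
  rewrite /sintegral -(@fsbig_widen _ _ _ _ [set c])//=.
    rewrite fsbig_set1; congr (_ * mu _).
    apply/seteqP; split=> [x Ax|x] /=; rewrite measurable_realfun.mindicE.
      by rewrite mem_set// mulr1.
    have [|_] := boolP (x \in A); first by rewrite inE.
    by rewrite mulr0 => c00; move: c0; rewrite -c00 ltxx.
  move=> r /= [_ rc]; have [->|r0] := eqVneq r 0%R; first by rewrite mul0e.
  rewrite (_ : _ @^-1` _ = set0) ?mu0 ?mule0//.
  rewrite -subset0 => x /=; rewrite measurable_realfun.mindicE.
  case: (x \in A); first by rewrite mulr1 => /esym.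
  by rewrite mulr0 => /esym/eqP; rewrite (negPf r0).
apply: ereal_sup_ubound; exists (scale_nnsfun (indic_nnsfun R mA) (ltW c0)) => //.
move=> x /=; rewrite patch_setT measurable_realfun.mindicE.
have [|_] := boolP (x \in A); first by rewrite inE mulr1 => /cf.
by rewrite mulr0.
Qed.

(** The hypothesis ranges over all subsets because [mu] is not assumed monotone.
It applies to the level sets of positive level of the simple functions below
[f]. *)
Lemma set_function_integral_eq0 (D : set T) (f : T -> \bar R) :
  (forall x, 0 <= f x) ->
  (forall A, A `<=` D `&` [set x | 0 < f x] -> mu A = 0) ->
  \int[mu]_(x in D) f x = 0.
Proof.
move=> f0 muD; rewrite set_function_ge0_integralE//.
rewrite (_ : image _ _ = [set 0]) ?ereal_sup1//.
apply/seteqP; split=> [_ [h /= hf <-]|_ ->].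
  apply: sintegral_eq0 => r r0; apply: muD => x /= hx.
  have := hf x; rewrite hx patchE.
  case: ifPn => [|_]; first by rewrite inE => Dx rf; split=> //; exact: lt_le_trans rf.
  by rewrite lee_fin leNgt r0.
exists nnsfun0; last exact: sintegral_nnsfun0.
by move=> x /=; rewrite patchE; case: ifP.
Qed.

End set_function_integral.

(** * Boxes in infinite dimension *)

Section boxes.
Variable R : realType.
Implicit Types (a b c : nat -> R).

(** If the bound holds from rank [n] on, then [x] lies in a box with finitely
many sides of length [2 * k] and all others equal to 1/2; such a box has
volume 0, and there are countably many of them. *)
Lemma flat_asymptotic c :
  flat [set x : borelRinfty R | \forall i \near \oo, `|x i - c i| < 4^-1].
Proof.
pose lo n k i : R := if (i < n)%N then - k%:R else c i - 4^-1.
pose hi n k i : R := if (i < n)%N then k%:R else c i + 4^-1.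
apply: (@flat_subset _ _ (\bigcup_n \bigcup_k open_box (lo n k) (hi n k))).
  move=> x [n _ xc]; exists n => //.
  pose M := \sum_(i < n) `|x i|.
  have [k Mk] : exists k : nat, M < k%:R.
    by exists (Num.truncn M).+1; rewrite truncnS_gt.
  exists k => // i; rewrite /lo /hi; case: ltnP => [iltn|nlei].
    rewrite -ltr_norml; apply: le_lt_trans Mk.
    by rewrite /M (bigD1 (Ordinal iltn))//= lerDl sumr_ge0.
  by have := xc i nlei; rewrite ltr_norml; lra.
apply: flat_bigcup => n; apply: flat_bigcup => k; apply: flat_open_box.
split=> [i|].
  by rewrite /lo /hi; case: ifP => _; [have := ler0n R k|]; lra.
apply: (@prod_tail_cvg0 _ (fun i => hi n k i - lo n k i) (fun=> 2^-1) n) => [i _|i ni|].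
- by rewrite invr_neq0// pnatr_eq0.
- by rewrite /lo /hi ltnNge ni/=; lra.
- under eq_fun do rewrite prodr_const card_ord.
  by apply: cvg_expr; rewrite ger0_norm//; lra.
Qed.

(** Otherwise every nonempty box of the cover fails to enclose the interval
from [a i] to [b i] for infinitely many [i]. Assign to each [j] such a coordinate [idx j], with [idx]
injective, and choose the [idx j]th coordinate of [x] to be an endpoint lying
outside the [j]th box: this [x] belongs to the parallelepiped but to no box of
the cover. *)
Lemma parallelepiped_cover_tail a b (l u : nat -> nat -> R) :
  (forall i, a i <= b i) ->
  parallelepiped a b `<=` \bigcup_j open_box (l j) (u j) ->
  exists j, (forall i, l j i < u j i) /\
    \forall i \near \oo, l j i < a i /\ b i < u j i.
Proof.
move=> ab cov; apply: contrapT => noj.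
have bad (jn : nat * nat) : exists i, (jn.2 <= i)%N /\
    ((forall i, l jn.1 i < u jn.1 i) -> ~ (l jn.1 i < a i /\ b i < u jn.1 i)).
  case: jn => j n /=; apply: contrapT => noi; apply: noj; exists j.
  split=> [|].
    by apply: contrapT => nlu; apply: noi; exists n; split.
  exists n => // i /= ni; apply: contrapT => nab; apply: noi.
  by exists i; split.
have [g gP] := choice bad.
pose idx := fix idx j := if j is j'.+1 then g (j, (idx j').+1) else g (0, 0)%N.
have idx_incr : {homo idx : i j / (i < j)%N}.
  apply: homo_ltn => [|j]; first exact: ltn_trans.
  by have [+ _] := gP (j.+1, (idx j).+1).
have idx_inj : injective idx.
  by move=> i j ij; case: (ltngtP i j) => // /idx_incr; rewrite ij ltnn.
have idxP j : (forall i, l j i < u j i) ->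
    ~ (l j (idx j) < a (idx j) /\ b (idx j) < u j (idx j)).
  by case: j => [|j]; [exact: (gP (0, 0)%N).2|exact: (gP (j.+1, (idx j).+1)).2].
pose x : borelRinfty R := fun i =>
  if pselect (exists j, idx j = i /\ ~ (b i < u j i)) then b i else a i.
have [|j _ xj] := cov x.
  by move=> i; rewrite /x; case: pselect => /= _; rewrite ab lexx.
apply: (idxP j) => [i|]; first by have /andP[] := xj i; exact: lt_trans.
have := xj (idx j); rewrite /x; case: pselect => /= [[j' [/idx_inj-> nb]]|nj].
  by move=> /andP[_ /nb].
move=> /andP[la _]; split=> //; apply: contrapT => nb.
by apply: nj; exists j.
Qed.

(** Take a box of a cover that encloses the parallelepiped in all coordinates
from some rank on. Its volume is not 0: otherwise enlarging finitely many of its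
sides would enclose the whole parallelepiped in a box of volume 0. So the sides
of this box tend to 1, and they eventually exceed those of the
parallelepiped. *)
Lemma parallelepiped_side_lt a b (e : R) : (forall i, a i <= b i) ->
  (0 < lebesgue_infty (parallelepiped a b) < +oo)%E -> 0 < e ->
  \forall i \near \oo, b i - a i < 1 + e.
Proof.
move=> ab /andP[P0 Poo] e0.
have [l [u [adm cov]]] := lebesgue_infty_cover Poo.
have [j [lu tail]] := parallelepiped_cover_tail ab cov.
have [v0|vn0] := eqVneq (volume (l j) (u j)) 0.
  have [_ flatlu] : flat_box (l j) (u j) by apply/flat_boxP.
  have [n _ nP] := tail.
  pose lo i := if (i < n)%N then a i - 1 else l j i.
  pose hi i := if (i < n)%N then b i + 1 else u j i.
  suff F : flat (parallelepiped a b).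
    by move: P0; rewrite lebesgue_infty_flat// ltxx.
  apply: (@flat_subset _ _ (open_box lo hi)).
    move=> x xab i; have := xab i; rewrite /lo /hi; case: ltnP => [_|/nP/=[]]; lra.
  apply: flat_open_box; split=> [i|].
    by rewrite /lo /hi; case: ifP => _; [have := ab i|have := lu i]; lra.
  apply: (@prod_tail_cvg0 _ (fun i => hi i - lo i) (fun i => u j i - l j i) n _ _ flatlu) => [i _|i ni].
    by rewrite subr_eq0 gt_eqF.
  by rewrite /lo /hi ltnNge ni.
have /cvgrPdist_lt/(_ e e0) : (fun i => u j i - l j i) @ \oo --> (1 : R).
  exact: prod_cvg_factor_cvg1 vn0 (adm j).2.
move=> side; near=> i.
have [] : l j i < a i /\ b i < u j i by near: i.
have : `|1 - (u j i - l j i)| < e by near: i.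
rewrite ltr_norml; lra.
Unshelve. all: end_near. Qed.

(** Where the sides are close to 1 and the centres are 1/4 apart, the
intersection has side at most about 3/4. Thus each such coordinate loses a fixed
factor with respect to the box, whose partial products converge. *)
Lemma flat_parallelepiped_open_box a b (l u : nat -> R) :
  (forall e, 0 < e -> \forall i \near \oo, b i - a i < 1 + e) ->
  admissible_box l u ->
  ~ (\forall i \near \oo, `|centre a b i - centre l u i| < 4^-1) ->
  flat (parallelepiped a b `&` open_box l u).
Proof.
move=> side adm far.
have [v0|vn0] := eqVneq (volume l u) 0.
  apply: (@flat_subset _ _ (open_box l u)); first by move=> x [].
  by apply: flat_open_box; apply/flat_boxP.
have [[x0 [x0ab x0lu]]|/nonemptyPn->] :=
    pselect (parallelepiped a b `&` open_box l u !=set0); last exact: flat0.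
have slu : (fun i => u i - l i) @ \oo --> (1 : R).
  exact: prod_cvg_factor_cvg1 vn0 adm.2.
(* The closed parallelepiped is thickened by 1/16 to make the intersection fit in
   an open box. When the side of the parallelepiped is at most 1 + 1/16 and that of
   the given box is within 1/16 of 1, the side of the new box is at most
   1 + 1/16 - 1/4 + 1/16 = 7/8 = 14/15 * (1 - 1/16). *)
pose lo i := Num.max (a i - 16^-1) (l i).
pose hi i := Num.min (b i + 16^-1) (u i).
apply: (@flat_subset _ _ (open_box lo hi)).
  move=> x [xab xlu] i; rewrite /lo /hi gt_max lt_min.
  by have := xab i; have := xlu i; lra.
have lohi i : lo i <= hi i.
  rewrite /lo /hi ge_max !le_min.
  by have := x0ab i; have := x0lu i; lra.
apply: flat_open_box; split=> //.
apply: (@prod_contract_cvg0 _ (fun i => hi i - lo i) (fun i => u i - l i) (14 / 15) _ _ _ adm.2).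
- lra.
- move=> i; rewrite subr_ge0 lohi/= lerB//; first by rewrite ge_min lexx orbT.
  by rewrite le_max lexx orbT.
move=> n.
have e0 : 0 < 16^-1 :> R by lra.
have [m _ mP] : \forall i \near \oo, b i - a i < 1 + 16^-1 /\
    `|1 - (u i - l i)| < 16^-1.
  apply: filterI; first exact: side.
  by move/cvgrPdist_lt : slu; exact.
have [i [mi far_i]] : exists i, (maxn n m <= i)%N /\
    ~ `|centre a b i - centre l u i| < 4^-1.
  apply: contrapT => noi; apply: far; exists (maxn n m) => // i /= mi.
  by apply: contrapT => ni; apply: noi; exists i.
move: mi; rewrite geq_max => /andP[ni mi]; exists i => //.
have [sab] := mP i mi; rewrite ltr_norml => slui.
move/negP : far_i; rewrite -leNgt ler_normr /centre => far_i.
have h1 : hi i <= u i by rewrite ge_min lexx orbT.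
have h2 : hi i <= b i + 16^-1 by rewrite ge_min lexx.
have l1 : l i <= lo i by rewrite le_max lexx orbT.
have l2 : a i - 16^-1 <= lo i by rewrite le_max lexx.
case/orP : far_i; lra.
Qed.

Lemma integrable_support_cover (f : borelRinfty R -> R) :
  measurable_fun setT f -> (forall x, 0 <= f x) ->
  (\int[@lebesgue_infty R]_(x in setT) (f x)%:E < +oo)%E ->
  exists a b : nat -> nat -> nat -> R,
    (forall n j, admissible_box (a n j) (b n j)) /\
    [set x | 0 < f x] `<=` \bigcup_n \bigcup_j open_box (a n j) (b n j).
Proof.
move=> mf f0 intf.
pose A n : set (borelRinfty R) := [set x | n.+1%:R^-1 <= f x].
have covA n : exists ab : (nat -> nat -> R) * (nat -> nat -> R),
    (forall j, admissible_box (ab.1 j) (ab.2 j)) /\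
    A n `<=` \bigcup_j open_box (ab.1 j) (ab.2 j).
  have mA : measurable (A n).
    rewrite (_ : A n = setT `&` f @^-1` `[n.+1%:R^-1, +oo[%classic).
      by apply: mf.
    by rewrite setTI; apply/seteqP; split=> x; rewrite /A /= in_itv/= andbT.
  have : (n.+1%:R^-1%:E * lebesgue_infty (A n) < +oo)%E.
    apply: le_lt_trans intf; apply: le_set_function_integral => //.
      exact: lebesgue_infty0.
  move=> Aoo; have [|a [b ab]] := @lebesgue_infty_cover _ (A n); last first.
    by exists (a, b).
  rewrite ltNge leye_eq; apply/negP => /eqP Eoo.
  by move: Aoo; rewrite Eoo gt0_muley// lte_fin.
have [g gP] := choice covA.
exists (fun n => (g n).1), (fun n => (g n).2); split=> [n j|x fx].
  exact: (gP n).1.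
have [n nx] : exists n : nat, n.+1%:R^-1 <= f x.
  exists (Num.truncn (f x)^-1); rewrite -[leRHS]invrK lef_pV2 ?posrE ?invr_gt0//.
  by apply: ltW; rewrite truncnS_gt.
by exists n => //; exact: (gP n).2.
Qed.

End boxes.

Local Open Scope ereal_scope.

Theorem theorem7p4p3 (R : realType) (f : borelRinfty R -> R)
    (mf : measurable_fun [set: borelRinfty R] f)
    (f_ge0 : forall x, (0 <= f x)%R)
    (f_int1 : \int[@lebesgue_infty R]_(x in [set: borelRinfty R]) (f x)%:E = 1) :
  {ae @lebesgue_infty R, forall x : borelRinfty R,
    forall e : R, (0 < e)%R -> exists2 delta : R, (0 < delta)%R &
      forall a b : nat -> R, (forall i, (a i <= b i)%R) -> centre a b = x ->
        0 < lebesgue_infty (parallelepiped a b) < delta%:E ->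
        `| (\int[@lebesgue_infty R]_(y in parallelepiped a b) (f y)%:E) /
           lebesgue_infty (parallelepiped a b) | < e%:E}.
Proof.
have [|l [u [adm cov]]] := integrable_support_cover mf f_ge0.
  by rewrite f_int1 ltry.
apply: flat_negligible.
pose N n j := [set x : borelRinfty R |
  \forall i \near \oo, (`|x i - centre (l n j) (u n j) i| < 4^-1)%R].
apply: (@flat_subset _ _ (\bigcup_n \bigcup_j N n j)); last first.
  apply: flat_bigcup => n; apply: flat_bigcup => j; exact: flat_asymptotic.
move=> x xbad; apply: contrapT => xN; apply: xbad => e e0.
exists 1%R => // a b ab cx /andP[P0 P1].
rewrite set_function_integral_eq0 ?mul0e ?abse0 ?lte_fin//.
  exact: lebesgue_infty0.
have side d : (0 < d)%R -> \forall i \near \oo, (b i - a i < 1 + d)%R.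
  apply: parallelepiped_side_lt => //; rewrite P0/=.
  by apply: lt_trans P1 _; rewrite ltry.
(* Inside the parallelepiped, [f] is positive only on its intersections with the
   boxes covering the support. *)
move=> A AP; apply: lebesgue_infty_flat.
apply: (@flat_subset _ _
  (\bigcup_n \bigcup_j (parallelepiped a b `&` open_box (l n j) (u n j)))).
  move=> y /AP[Py]; rewrite /= lte_fin => /cov[n _ [j _ yj]].
  by exists n => //; exists j.
apply: flat_bigcup => n; apply: flat_bigcup => j.
apply: flat_parallelepiped_open_box => // xnj; apply: xN.
by exists n => //; exists j => //; rewrite /N /= -cx.
Qed.
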